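(* Let $f$ be a Boolean function with triples table $triples(f)$ and canonical Independent primesets $PS_1,\dots,PS_N$. The cascade list resulting from cascading $PS_1\cup\dots\cup PS_N$ through $triples(f)$ contains all of the products in $triples(f)$.
   Context: Products are conjunctions of literals; primes are minimal implicants of $f$. Consensus $(U\circ V)$ of products with exactly one reversal variable is the product of their other literals; $\mathrm{Consensus}(S)$ is the closure of $S$ under valid consensus; Essential primes are primes not in the consensus closure of the other primes; $\langle Free\rangle=\mathrm{Consensus}(\text{Essentials})$; products of $\mathrm{Consensus}(\text{all primes})$ not in $\langle Free\rangle$ are non-free, indexed $X_1,X_2,\dots$. The table $triples(f)$ consists of index triples $(r,i,j)$, $j\ge0$ (meaning: if $X_i$ and, when $j>0$, $X_j$ are covered then $X_r$ is covered; index 0 = free product): $(r,i,j)$ for each consensus $X_r=(X_i\circ X_j)$ of non-free products with $X_r$ non-free, $(r,i,0)$ for each consensus of non-free $X_i$ with a free product giving non-free $X_r$, and $(r,k,0)$ for non-free $X_r\in\mathrm{Consensus}(\langle Free\rangle\cup\{X_k\})$ for certain non-free primes $X_k$; then useless entries ($(r,i,j)$, $j>0$, when $(r,i,0)$ or $(r,j,0)$ is present) and, repeatedly, entries whose first index never appears in a second/third position are removed. Cascade of a set $S$ through a table $T'$: start with list $L=S$; delete all entries with first index in $L$; replace indices of $L$ in second/third positions by $0$; for each entry that becomes $(t,0,0)$ append $t$ to $L$ (and delete its entries); iterate until no new index; the final $L$ is the cascade list. Parents: for $(r,i,0)$, $i$; for $(r,i,j)$, $j>0$, $i$ and $j$.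 $Anc(r)$: parents, parents of parents, etc.; Ancestor Sets are sets $Anc(r)$; Independent Ancestor Sets are those not properly containing another Ancestor Set; the primeset of $A$ is the set of primes in $A$; $triples(A)$ is the set of entries $(r,i,j)$ with $r,i\in A$ and ($j=0$ or $j\in A$). The canonical Independent Ancestor Sets $A_1,\dots,A_N$ of $f$ are produced iteratively: starting with the current table $T=triples(f)$, (1) remove useless entries and inactive indices; (2) find all Independent Ancestor Sets of the current $T$; (3) for each such $A$, set aside $triples(A)$ and remove those entries from $T$; (4) cascade the union of these Independent Ancestor Sets through $T$, removing all covered indices; (5) repeat while $T$ is nonempty. $A_1,\dots,A_N$ are all sets found in step (2) over all iterations, and $PS_i$ is the primeset of $A_i$. *)

(* Defs.v *)
From mathcomp Require Import all_boot.
Set Implicit Arguments.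
Unset Strict Implicit.
Unset Printing Implicit Defensive.

Definition boolfun (n : nat) := {ffun 'I_n -> bool} -> bool.

(* A conjunction of literals in the variables x_0, ..., x_(n-1): U x is
   [Some true] if the literal x occurs, [Some false] if its complement occurs,
   and [None] if the variable x does not occur. *)
Definition product (n : nat) := {ffun 'I_n -> option bool}.

Section Products.
Variable n : nat.
Implicit Types (f : boolfun n) (U V W : product n) (S : {set product n}).

Definition satisfies (a : {ffun 'I_n -> bool}) U : bool :=
  [forall x, (U x == None) || (U x == Some (a x))].

Definition implicant f U : bool := [forall a, satisfies a U ==> f a].

Definition subproduct V U : bool := [forall x, (V x == None) || (V x == U x)].

Definition prime_implicant f U : bool :=
  implicant f U && [forall V, (implicant f V && subproduct V U) ==> (V == U)].

Definition primes_of f : {set product n} := [set U | prime_implicant f U].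

Definition reversals U V : {set 'I_n} :=
  [set x | [exists b, (U x == Some b) && (V x == Some (~~ b))]].

(* [None] when the consensus is not valid. *)
Definition consensus U V : option (product n) :=
  if #|reversals U V| == 1 then
    Some [ffun x => if x \in reversals U V then None
                    else if U x is Some b then Some b else V x]
  else None.

Definition Consensus S : {set product n} :=
  fixset (fun X => S :|: [set W | [exists U in X, exists V in X,
                                     consensus U V == Some W]]).

Definition essentials f : {set product n} :=
  [set U in primes_of f | U \notin Consensus (primes_of f :\ U)].

Definition free f : {set product n} := Consensus (essentials f).

Definition nonfree f : {set product n} := Consensus (primes_of f) :\: free f.

Definition nonfree_primes f : {set product n} := primes_of f :&: nonfree f.

End Products.

(* The triple (r, i, j).  A non-free product serves as its own index, and the
   index 0 is [None]. *)
Definition entry (n : nat) : Type :=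
  (product n * option (product n) * option (product n))%type.

Section Tables.
Variable n : nat.
Implicit Types (f : boolfun n) (e : entry n) (T : {set entry n}).
Implicit Types (p r : product n) (i j : option (product n)).
Implicit Types (A L S K : {set product n}).

Definition head e : product n := e.1.1.

Definition parents e : {set product n} :=
  [set p | (e.1.2 == Some p) || (e.2 == Some p)].

Definition active T : {set product n} := \bigcup_(e in T) parents e.

Definition products_of T : {set product n} := [set head e | e in T] :|: active T.

Definition useless T e : bool :=
  let: (r, i, j) := e in
  (j != None) && (((r, i, None) \in T) || ((r, j, None) \in T)).

Definition remove_useless T : {set entry n} := [set e in T | ~~ useless T e].

(* Each pass that changes the table deletes an entry, so #|T| passes reach the
   stable table. *)
Definition remove_inactive T : {set entry n} :=
  iter #|T| (fun T' => [set e in T' | head e \in active T']) T.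

Definition reduce T : {set entry n} := remove_inactive (remove_useless T).

(* K is the set of non-free primes X_k for which the derived entries (r, k, 0)
   with X_r in Consensus(<Free> U {X_k}) are listed.  As consensus is symmetric,
   (r, i, j) and (r, j, i) occur together when j is not 0. *)
Definition all_triples f K : {set entry n} :=
  [set e : entry n | let: (r, i, j) := e in
     (r \in nonfree f) &&
     match i, j with
     | Some u, Some v =>
         [&& u \in nonfree f, v \in nonfree f & consensus u v == Some r]
     | Some u, None =>
         ((u \in nonfree f) && [exists v in free f, consensus u v == Some r])
         || [&& u \in K, r != u & r \in Consensus (u |: free f)]
     | None, _ => false
     end].

Definition triples f K : {set entry n} := reduce (all_triples f K).

Definition zero_in L i : option (product n) :=
  if i is Some p then if p \in L then None else Some p else None.

(* (r, 0, j) is written (r, j, 0). *)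
Definition replace0 L e : entry n :=
  let: (r, i, j) := e in
  if zero_in L i is Some p then (r, Some p, zero_in L j)
  else (r, zero_in L j, None).

Definition cascade_step (s : {set product n} * {set entry n}) :
    {set product n} * {set entry n} :=
  let: (L, T) := s in
  let T' := [set replace0 L e | e in T & head e \notin L] in
  (L :|: [set t | (t, None, None) \in T'], T').

(* L can grow at most #|product n| times; the extra step deletes the entries of
   the indices that were appended last. *)
Definition cascade S T : {set product n} * {set entry n} :=
  iter #|{: product n}|.+1 cascade_step (S, T).

Definition cascade_list S T : {set product n} := (cascade S T).1.

Definition cascade_table S T : {set entry n} := (cascade S T).2.

Definition parent T : rel (product n) :=
  [rel p r | [exists e in T, (head e == r) && (p \in parents e)]].

Definition Anc T r : {set product n} :=
  [set a | [exists p, connect (parent T) a p && parent T p r]].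

Definition ancestor_sets T : {set {set product n}} :=
  [set Anc T r | r in products_of T].

Definition independent_sets T : {set {set product n}} :=
  [set A in ancestor_sets T | [forall B in ancestor_sets T, ~~ (B \proper A)]].

Definition triples_in T A : {set entry n} :=
  [set e in T | (head e \in A) && (parents e \subset A)].

Definition next_table T : {set entry n} :=
  cascade_table (\bigcup_(A in independent_sets T) A)
                (T :\: \bigcup_(A in independent_sets T) triples_in T A).

Fixpoint independent_rounds (k : nat) T : seq {set product n} :=
  if k is k'.+1 then
    if T == set0 then [::]
    else enum (independent_sets (reduce T))
           ++ independent_rounds k' (next_table (reduce T))
  else [::].

(* Every round started on a nonempty table deletes at least one entry, so
   #|triples f K| rounds exhaust the table. *)
Definition canonical_sets f K : seq {set product n} :=
  independent_rounds #|triples f K| (triples f K).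

Definition primeset f A : {set product n} := A :&: primes_of f.

Definition canonical_primesets f K : seq {set product n} :=
  [seq primeset f A | A <- canonical_sets f K].

End Tables.

(* Main.v *)
(** Let C be the cascade list of the primesets.  It is closed under the entries
    of triples(f), hence under those of every later table, which only have
    covered parents erased.  Every entry of the original table whose head is
    still present in a later table is subsumed there by an entry with the same
    head and no new parents.  So if A is an ancestor set found in some round, it
    contains, for each of its non-prime products W = U o V, the parents of an
    entry with head W and parents among U and V; induction on the consensus
    derivation of W from the primes then gives A <= C.  By
    downward induction on the rounds every product lies in C: one removed by a
    cascade is reached from such sets A, and one removed as inactive has all its
    parents among the products that stay in the table. *)
Require Import Defs.
From mathcomp Require Import all_boot.
(* Again, so that [head] is the head of an entry and not [seq.head]. *)
Import Defs.
Set Implicit Arguments.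
Unset Strict Implicit.
Unset Printing Implicit Defensive.

(** * Consensus closure: fixed point, induction and symmetry *)

Section ConsensusClosure.
Variable n : nat.
Implicit Types (f : boolfun n) (U V W : product n) (S X : {set product n}).

Let step S X := S :|: [set W | [exists U in X, exists V in X,
                                  consensus U V == Some W]].

Lemma consensus_step_mono S : {homo step S : X Y / X \subset Y}.
Proof.
move=> X Y sXY; apply: setUS; apply/subsetP => W; rewrite !inE.
case/existsP=> U /andP[XU /existsP[V /andP[XV UV]]].
apply/existsP; exists U; rewrite (subsetP sXY) //=.
by apply/existsP; exists V; rewrite (subsetP sXY).
Qed.

Lemma Consensus_step S : step S (Consensus S) = Consensus S.
Proof. exact: fixsetK (consensus_step_mono S). Qed.

Lemma sub_Consensus S : S \subset Consensus S.
Proof. by rewrite -Consensus_step subsetUl. Qed.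

Lemma Consensus_closed S U V W : U \in Consensus S -> V \in Consensus S ->
  consensus U V = Some W -> W \in Consensus S.
Proof.
move=> SU SV UVW; rewrite -Consensus_step !inE; apply/orP; right.
apply/existsP; exists U; rewrite SU; apply/existsP; exists V.
by rewrite SV UVW eqxx.
Qed.

Lemma Consensus_inv S W : W \in Consensus S ->
  W \in S \/ exists U V, [/\ U \in Consensus S, V \in Consensus S
                          & consensus U V = Some W].
Proof.
rewrite -{1}Consensus_step !inE => /orP[|]; first by left.
case/existsP=> U /andP[SU /existsP[V /andP[SV /eqP UVW]]].
by right; exists U, V.
Qed.

(** [Consensus_step] gives a fixed point but not that it is the least one. Leastness comes from
    unfolding [fixset] into iterates from the empty set and inducting on the stage. *)
Lemma Consensus_ind S (P : product n -> Prop) :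
  (forall U, U \in S -> P U) ->
  (forall U V W, U \in Consensus S -> V \in Consensus S -> P U -> P V ->
     consensus U V = Some W -> P W) ->
  forall W, W \in Consensus S -> P W.
Proof.
move=> PS Pstep; rewrite /Consensus /fixset -/(step S).
suff: forall m W, W \in iter m (step S) set0 -> W \in Consensus S /\ P W.
  by move=> H W /H[].
elim=> [|m IHm] W; first by rewrite inE.
rewrite iterS !inE => /orP[SW|].
  by split; [apply: (subsetP (sub_Consensus S)) | apply: PS].
case/existsP=> U /andP[/IHm[SU PU] /existsP[V /andP[/IHm[SV PV] /eqP UVW]]].
by split; [apply: Consensus_closed UVW | apply: (Pstep U V)].
Qed.

Lemma ConsensusS S X : S \subset X -> Consensus S \subset Consensus X.
Proof.
move=> sSX; apply/subsetP; apply: Consensus_ind => [U SU|U V W _ _].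
  exact: (subsetP (sub_Consensus X)) (subsetP sSX _ SU).
exact: Consensus_closed.
Qed.

Lemma reversalsC U V : reversals U V = reversals V U.
Proof.
apply/setP=> x; rewrite !inE.
by apply/existsP/existsP=> -[b /andP[Ub Vb]]; exists (~~ b); rewrite negbK Ub Vb.
Qed.

(** The definition prefers the literal of [U], but outside the reversal variables two literals of
    the same variable agree, so the preference is immaterial. *)
Lemma consensusC U V : consensus U V = consensus V U.
Proof.
rewrite /consensus (reversalsC V); case: ifP => // _; congr Some.
apply/ffunP=> x; rewrite !ffunE; case: ifP => //.
case DU: (U x) => [b|]; case DV: (V x) => [c|] //.
rewrite inE => /existsP nrev; case: (eqVneq b c) => [-> //|neq_bc].
by case: nrev; exists b; rewrite DU DV eqxx; case: b c neq_bc {DU DV} => [] [].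
Qed.

End ConsensusClosure.

Section Tables.
Variable n : nat.
Implicit Types (f : boolfun n) (U V W r p : product n).
Implicit Types (e : entry n) (T : {set entry n}) (A C K L S : {set product n}).

Definition heads T : {set product n} := [set head e | e in T].

Definition closed_under T C : Prop :=
  forall e, e \in T -> parents e \subset C -> head e \in C.

Lemma head_in T e : e \in T -> head e \in heads T.
Proof. exact: imset_f. Qed.

Lemma headsP T r : reflect (exists2 e, e \in T & r = head e) (r \in heads T).
Proof. exact: imsetP. Qed.

Lemma activeP T p :
  reflect (exists2 e, e \in T & p \in parents e) (p \in active T).
Proof. exact: bigcupP. Qed.

(** * Cascading as forward chaining *)

Lemma head_replace0 L e : head (replace0 L e) = head e.
Proof. by case: e => [[r i] j] /=; case: (zero_in L i). Qed.

Lemma parents_replace0 L e : parents (replace0 L e) = parents e :\: L.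
Proof.
apply/setP=> p; case: e => [[r i] j]; rewrite !inE /=.
have zE (k : option (product n)) :
    (zero_in L k == Some p) = (p \notin L) && (k == Some p).
  case: k => [q|] /=; last by rewrite andbF.
  have [[<-]|neq] := eqVneq (Some q) (Some p); last first.
    by rewrite andbF; case: ifP => // _; apply: negbTE.
  by rewrite andbT; case: (q \in L); rewrite ?eqxx.
rewrite andb_orr -!zE; case: (zero_in L i) => //=.
by rewrite orbF.
Qed.

Lemma replace0_covered L e :
  parents e \subset L -> replace0 L e = (head e, None, None).
Proof.
rewrite -setD_eq0 -parents_replace0 -(head_replace0 L).
case: (replace0 L e) => [[r [i|]] [j|]] //= /eqP/setP H.
- by have := H i; rewrite !inE eqxx.
- by have := H i; rewrite !inE eqxx.
- by have := H j; rewrite !inE eqxx.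
Qed.

(** A lone surviving parent is always shifted to the second position, so erasing in two stages
    reaches the same normal form as erasing once. The repeated rewriting of a cascade thus collapses
    to a single one. *)
Lemma replace0_replace0 L L' e :
  L \subset L' -> replace0 L' (replace0 L e) = replace0 L' e.
Proof.
move=> sLL'; have zz i : zero_in L' (zero_in L i) = zero_in L' i.
  case: i => //= q; case: ifP => //= /(subsetP sLL') -> //.
case: e => [[r i] j] /=; rewrite -(zz i).
by case: (zero_in L i) => [p|] /=; rewrite zz //; case: (zero_in L' j).
Qed.

(** Forward chaining on a fixed table: unlike in [cascade_step], no entry is deleted or
    rewritten. *)
Definition deduce T L : {set product n} :=
  L :|: [set head e | e in [set e in T | parents e \subset L]].

Definition cover S T : {set product n} := iter #|{: product n}| (deduce T) S.

Lemma iter_deduce_sub T S m : S \subset iter m (deduce T) S.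
Proof. by elim: m => //= m IH; apply: subset_trans IH (subsetUl _ _). Qed.

Lemma sub_cover S T : S \subset cover S T.
Proof. exact: iter_deduce_sub. Qed.

Lemma deduce_cover S T : deduce T (cover S T) = cover S T.
Proof.
(* Each round before stabilization adds a product. With [m] the number of all products, the second
   alternative forces the full set, which is stationary too. *)
suff: forall m, deduce T (iter m (deduce T) S) = iter m (deduce T) S
             \/ m <= #|iter m (deduce T) S|.
  case/(_ #|{: product n}|) => // full.
  suff -> : cover S T = setT by rewrite /deduce setTU.
  by apply/eqP; rewrite eqEcard subsetT cardsT.
elim=> [|m [IH|IH]]; [by right | by left; rewrite /= IH|].
case: (eqVneq (deduce T (iter m (deduce T) S)) (iter m (deduce T) S)) => [E|ne].
  by left; rewrite /= E.
right; apply: leq_ltn_trans IH _; apply: proper_card.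
by rewrite properEneq eq_sym ne subsetUl.
Qed.

Lemma closed_cover S T : closed_under T (cover S T).
Proof.
move=> e Te se; rewrite -deduce_cover !inE; apply/orP; right.
by apply: imset_f; rewrite inE Te.
Qed.

Lemma cover_min S T C : S \subset C -> closed_under T C -> cover S T \subset C.
Proof.
move=> sSC clC; rewrite /cover; elim: #|_| => //= m IH.
rewrite subUset IH; apply/subsetP => r /imsetP[e]; rewrite inE => /andP[Te se] ->.
by apply: clC => //; apply: subset_trans se IH.
Qed.

(** An entry becomes [(t, None, None)] exactly when all its parents lie in [L]; the entries deleted
    beforehand have their heads in [L] and would add nothing. *)
Lemma cascade_stepE L T :
  cascade_step (L, T) =
    (deduce T L, [set replace0 L e | e in T & head e \notin L]).
Proof.
congr pair; apply/setP=> t; rewrite !inE; case Lt: (t \in L) => //=.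
apply/imsetP/imsetP=> [] [e]; rewrite inE => /andP[Te He] E.
  exists e; last by rewrite -(head_replace0 L e) -E.
  rewrite inE Te -setD_eq0 -parents_replace0 -E; apply/eqP/setP => p.
  by rewrite !inE.
by exists e; rewrite ?inE ?Te -?E ?Lt // replace0_covered // -E.
Qed.

Lemma cascade_step_replace0 L L' T : L \subset L' ->
  cascade_step (L', [set replace0 L e | e in T & head e \notin L]) =
    cascade_step (L', T).
Proof.
move=> sLL'; rewrite /cascade_step.
suff -> : [set replace0 L' e
            | e in [set replace0 L e | e in T & head e \notin L]
            & head e \notin L']
        = [set replace0 L' e | e in T & head e \notin L'] by [].
apply/setP=> e; apply/imsetP/imsetP=> [] [e1].
  rewrite inE => /andP[/imsetP[e2]]; rewrite inE => /andP[Te2 _] ->.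
  rewrite head_replace0 replace0_replace0 // => Le2 ->.
  by exists e2; rewrite // inE Te2.
rewrite inE => /andP[Te1 Le1] ->; exists (replace0 L e1).
  rewrite inE head_replace0 Le1 andbT; apply: imset_f; rewrite inE Te1 /=.
  by apply: contra Le1; apply: (subsetP sLL').
by rewrite replace0_replace0.
Qed.

Lemma cascadeE S T :
  cascade S T =
    (cover S T, [set replace0 (cover S T) e | e in T & head e \notin cover S T]).
Proof.
(* The table lags one stage behind the list: after [m.+1] steps it is rewritten by the list of stage
   [m]. The extra step of [cascade] therefore rewrites it by the final list. *)
have iterE m :
    iter m.+1 (@cascade_step n) (S, T) =
      (iter m.+1 (deduce T) S,
       [set replace0 (iter m (deduce T) S) e
         | e in T & head e \notin iter m (deduce T) S]).
  elim: m => [|m IH]; first exact: cascade_stepE.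
  by rewrite iterS IH cascade_step_replace0 ?cascade_stepE //= subsetUl.
by rewrite /cascade iterE iterS -/(cover S T) deduce_cover.
Qed.

Lemma cascade_listE S T : cascade_list S T = cover S T.
Proof. by rewrite /cascade_list cascadeE. Qed.

Lemma next_tableE T (Q := \bigcup_(A in independent_sets T) A)
    (T' := T :\: \bigcup_(A in independent_sets T) triples_in T A) :
  next_table T =
    [set replace0 (cover Q T') e | e in T' & head e \notin cover Q T'].
Proof. by rewrite /next_table /cascade_table cascadeE. Qed.

(** * Reduction of tables and ancestor sets *)

Lemma active_sub T T' : T' \subset T -> active T' \subset active T.
Proof.
move=> sT; apply/subsetP=> p /activeP[e Te ep]; apply/activeP.
by exists e; rewrite ?(subsetP sT).
Qed.

Lemma closed_sub T T' C : T' \subset T -> closed_under T C -> closed_under T' C.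
Proof. by move=> sT cl e /(subsetP sT); apply: cl. Qed.

Lemma useless_sub T : remove_useless T \subset T.
Proof. by apply/subsetP=> e; rewrite inE => /andP[]. Qed.

(** What makes an entry useless is an entry with last component [None], and such an entry is never
    useless itself. *)
Lemma subsumed_useless T e : e \in T ->
  exists2 e', e' \in remove_useless T
            & head e' = head e /\ parents e' \subset parents e.
Proof.
move=> Te; case Ue: (useless T e); last by exists e; rewrite // inE Te Ue.
case: e Te Ue => [[r i] j] Te /= /andP[_ /orP[] Te'].
  exists (r, i, None); first by rewrite inE Te'.
  by split=> //; apply/subsetP=> p; rewrite !inE orbF => ->.
exists (r, j, None); first by rewrite inE Te'.
by split=> //; apply/subsetP=> p; rewrite !inE orbF => ->; rewrite orbT.
Qed.

Lemma reduce_sub T : reduce T \subset T.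
Proof.
apply: subset_trans (useless_sub T); rewrite /reduce /remove_inactive.
elim: #|_| => //= m IH; apply: subset_trans IH.
by apply/subsetP=> e; rewrite inE => /andP[].
Qed.

Lemma Anc_active T r : Anc T r \subset active T.
Proof.
apply/subsetP=> a; rewrite inE => /existsP[p /andP[ap pr]].
have par x y : parent T x y -> x \in active T.
  by case/existsP=> e /and3P[Te _ xe]; apply/activeP; exists e.
case/connectP: ap => [[|b s]] /=; first by move=> _ E; apply: (par a r); rewrite -E.
by case/andP=> /par.
Qed.

(** The product [r] need not belong to its own ancestor set, hence the two alternatives for the
    head. *)
Lemma parents_Anc T r e : e \in T -> head e = r \/ head e \in Anc T r ->
  parents e \subset Anc T r.
Proof.
move=> Te He; apply/subsetP=> p ep.
have pe : parent T p (head e) by apply/existsP; exists e; rewrite Te eqxx.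
rewrite inE; case: He => [<-|]; first by apply/existsP; exists p; rewrite connect0.
rewrite inE => /existsP[q /andP[eq qr]]; apply/existsP; exists q.
by rewrite qr (connect_trans (connect1 pe)).
Qed.

Lemma exists_independent T r : r \in products_of T ->
  exists A, A \in independent_sets T.
Proof.
move=> Tr; have Ar : Anc T r \in ancestor_sets T by apply: imset_f.
case: (arg_minnP (fun A : {set product n} => #|A|) Ar) => A TA minA.
exists A; rewrite inE; apply/andP; split=> //.
apply/forall_inP => B /minA leAB.
by apply/negP => /proper_card; rewrite ltnNge leAB.
Qed.

(** * Adequacy and its preservation from round to round *)

Section Subsumption.
Variable B : {set entry n}.

(* B is the complete table.  An entry of B whose head survives in T must still
   be present up to erasing parents and dropping weaker entries; this is what
   lets a consensus derivation be replayed inside T. *)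
Definition adequate T : Prop :=
  [/\ active T \subset heads T, heads T \subset heads B
    & forall b, b \in B -> head b \in heads T ->
        exists2 e, e \in T & head e = head b /\ parents e \subset parents b].

Lemma adequate_useless T : adequate T -> adequate (remove_useless T).
Proof.
case=> aT hT sT.
have EH : heads (remove_useless T) = heads T.
  apply/eqP; rewrite eqEsubset imsetS ?useless_sub //=.
  apply/subsetP=> _ /headsP[e /subsumed_useless[e' Te' [<- _]] ->].
  exact: head_in.
split; rewrite ?EH //; first exact: subset_trans (active_sub (useless_sub T)) aT.
move=> b Bb /(sT b Bb)[e Te [He pe]].
have [e' Te' [He' pe']] := subsumed_useless Te.
by exists e' => //; split; [rewrite He' | apply: subset_trans pe' pe].
Qed.

Lemma heads_active T : active T \subset heads T ->
  active T \subset heads [set e in T | head e \in active T].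
Proof.
move=> aT; apply/subsetP=> p ap; have /headsP[e Te pe] := subsetP aT p ap.
by rewrite pe head_in // inE Te -pe.
Qed.

Lemma adequate_active T :
  adequate T -> adequate [set e in T | head e \in active T].
Proof.
set T' := [set e in T | _]; case=> aT hT sT.
have sT'T : T' \subset T by apply/subsetP=> e; rewrite inE => /andP[].
split.
- exact: subset_trans (active_sub sT'T) (heads_active aT).
- exact: subset_trans (imsetS _ sT'T) hT.
move=> b Bb /headsP[e]; rewrite inE => /andP[Te ae] be.
have [|e' Te' [He' pe']] := sT b Bb; first by rewrite be head_in.
by exists e'; rewrite // inE Te' He' be.
Qed.

Lemma adequate_reduce T : adequate T -> adequate (reduce T).
Proof.
move/adequate_useless; rewrite /reduce /remove_inactive.
by elim: #|_| => //= m IH /IH; apply: adequate_active.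
Qed.

(** The passes are undone from the last to the first. All parents of a dropped entry are active,
    hence heads of kept entries and already in [C]; closure then returns the dropped head. *)
Lemma heads_reduce_closed T C : adequate T -> closed_under T C ->
  heads (reduce T) \subset C -> heads T \subset C.
Proof.
move=> adT clT hC.
have clU := closed_sub (useless_sub T) clT; have adU := adequate_useless adT.
suff hU : heads (remove_useless T) \subset C.
  apply/subsetP=> _ /headsP[e /subsumed_useless[e' Te' [<- _]] ->].
  by apply: (subsetP hU); apply: head_in.
move: hC; rewrite /reduce /remove_inactive.
move: (remove_useless T) (#|_|) clU adU => U m; elim: m U => // m IH U clU adU.
rewrite iterSr => /IH; set U' := [set e in U | _] => hC.
have sU'U : U' \subset U by apply/subsetP=> e; rewrite inE => /andP[].
have {}hC := hC (closed_sub sU'U clU) (adequate_active adU).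
apply/subsetP=> _ /headsP[e Ue ->]; apply: clU => //.
apply/subsetP=> p ep; apply: (subsetP hC).
case: adU => aU _ _; apply: (subsetP (heads_active aU)).
by apply/activeP; exists e.
Qed.

Lemma independentP T A : A \in independent_sets T ->
  exists2 r, r \in products_of T & A = Anc T r.
Proof. by rewrite inE => /andP[/imsetP[r Tr ->] _]; exists r. Qed.

Lemma adequate_next T : adequate T -> adequate (next_table T).
Proof.
case=> aT hT sT; rewrite next_tableE.
set Q := \bigcup_(A in _) A; set T' := T :\: _; set L := cover Q T'.
(* An entry set aside has its head in an independent set, hence in [L], so setting entries aside
   affects no head that survives the cascade. *)
have T'in e : e \in T -> head e \notin L -> e \in T'.
  move=> Te; rewrite inE Te andbT; apply: contra => /bigcupP[A TA].
  rewrite inE => /and3P[_ Ae _]; apply: (subsetP (sub_cover Q T')).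
  by apply/bigcupP; exists A.
have next_in e : e \in T -> head e \notin L ->
    replace0 L e \in [set replace0 L e | e in T' & head e \notin L].
  by move=> Te Le; apply: imset_f; rewrite inE T'in.
split.
- apply/subsetP=> p /activeP[x /imsetP[e]]; rewrite inE => /andP[/setDP[Te _] _] ->.
  rewrite parents_replace0 inE => /andP[Lp ep].
  have /headsP[e' Te' pe'] : p \in heads T.
    by apply: (subsetP aT); apply/activeP; exists e.
  by rewrite pe' -(head_replace0 L); apply/head_in/next_in; rewrite -?pe'.
- apply/subsetP=> y /headsP[x /imsetP[e]]; rewrite inE.
  case/andP=> /setDP[Te _] _ -> ->; rewrite head_replace0.
  by apply: (subsetP hT); apply: head_in.
move=> b Bb /headsP[x /imsetP[e]]; rewrite inE => /andP[/setDP[Te _] Le] ->.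
rewrite head_replace0 => be.
have [|e' Te' [He' pe']] := sT b Bb; first by rewrite be head_in.
exists (replace0 L e'); first by apply: next_in; rewrite // He' be.
rewrite head_replace0 parents_replace0; split=> //.
exact: subset_trans (subsetDl _ _) pe'.
Qed.

(** Any independent set [A = Anc T r] exhibits an entry that disappears. A member of [A] is covered
    and is the head of some entry; if [A] is empty, an entry with head [r] has no parents and fires
    at once unless it was set aside. *)
Lemma card_next_table T : adequate T -> T != set0 -> #|next_table T| < #|T|.
Proof.
case=> aT _ _ /set0Pn[e0 Te0]; rewrite next_tableE.
set Q := \bigcup_(A in _) A; set T' := T :\: _; set L := cover Q T'.
apply: leq_ltn_trans (leq_imset_card _ _) _; apply: proper_card.
have sT : [set e in T' | head e \notin L] \subset T.
  by apply/subsetP=> e; rewrite inE => /andP[/setDP[]].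
rewrite properE sT; apply/subsetPn.
have [|A IA] := @exists_independent T (head e0).
  by rewrite inE imset_f.
have QA : A \subset L.
  apply: subset_trans (sub_cover Q T'); exact: (bigcup_sup A).
suff [e Te Le] : exists2 e, e \in T & e \in T' -> head e \in L.
  by exists e => //; rewrite inE; apply/negP => /andP[/Le ->].
have [r Tr EA] := independentP IA.
have {}Tr : r \in heads T.
  by move: Tr; rewrite inE => /orP[//|]; apply: (subsetP aT).
case: (set_0Vmem A) => [A0|[x Ax]].
  have /headsP[e Te re] := Tr; exists e => // T'e.
  apply: closed_cover => //; apply: subset_trans (sub0set _).
  by rewrite -A0 EA; apply: parents_Anc => //; left.
have /headsP[e Te xe] : x \in heads T.
  by apply: (subsetP aT); apply: (subsetP (Anc_active T r)); rewrite -EA.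
by exists e => // _; rewrite -xe; apply: (subsetP QA).
Qed.

End Subsumption.

(** * Replaying consensus derivations inside the tables *)

(* When W = U o V with only one of U and V free, the entry is (W, U, 0). *)
Lemma consensus_entry f K U V W :
  U \in Consensus (primes_of f) -> V \in Consensus (primes_of f) ->
  consensus U V = Some W -> W \in nonfree f ->
  exists2 b, b \in all_triples f K & head b = W /\ parents b \subset [set U; V].
Proof.
move=> PU PV UVW nW.
have [fU|nU] := boolP (U \in free f); have [fV|nV] := boolP (V \in free f).
- have fW : W \in free f := Consensus_closed fU fV UVW.
  by move: nW; rewrite inE fW.
- exists (W, Some V, None).
    rewrite inE nW; apply/orP; left; rewrite inE nV PV.
    by apply/existsP; exists U; rewrite fU consensusC UVW /=.
  by split=> //; apply/subsetP=> p; rewrite !inE orbF => /eqP[->]; rewrite eqxx orbT.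
- exists (W, Some U, None).
    rewrite inE nW; apply/orP; left; rewrite inE nU PU.
    by apply/existsP; exists V; rewrite fV UVW /=.
  by split=> //; apply/subsetP=> p; rewrite !inE orbF => /eqP[->]; rewrite eqxx.
exists (W, Some U, Some V); first by rewrite inE nW inE nU PU inE nV PV UVW /=.
by split=> //; apply/subsetP=> p; rewrite !inE => /orP[] /eqP[->]; rewrite eqxx ?orbT.
Qed.

Lemma heads_all_triples f K : heads (all_triples f K) = nonfree f.
Proof.
apply/setP=> W; apply/headsP/idP=> [[[[r i] j]]|nW].
  by rewrite inE => /andP[nr _] ->.
have /setDP[PW fW] := nW.
have use U V : U \in Consensus (primes_of f) -> V \in Consensus (primes_of f) ->
    consensus U V = Some W -> exists2 e, e \in all_triples f K & W = head e.
  by move=> PU PV /(consensus_entry K PU PV)/(_ nW)[b Bb [<- _]]; exists b.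
case: (Consensus_inv PW) => [primeW|[U [V [PU PV]]]]; last exact: use.
(* A non-free prime is not essential, so it lies in the closure of the other primes; not being one
   of them, it is a consensus. *)
have : W \in Consensus (primes_of f :\ W).
  apply: contraNT fW => W'; apply: (subsetP (sub_Consensus _)).
  by rewrite inE primeW.
case/Consensus_inv => [|[U [V [PU PV]]]]; first by rewrite !inE eqxx.
by apply: use; apply: (subsetP (ConsensusS (subsetDl _ _))); eassumption.
Qed.

(** Every parent must itself be a head, that is, non-free. For the derived entries this follows from
    the hypothesis on [K]. *)
Lemma adequate_all_triples f K :
  K \subset nonfree_primes f -> adequate (all_triples f K) (all_triples f K).
Proof.
move=> hK; split=> // [|b Bb _]; last by exists b.
rewrite heads_all_triples; apply/subsetP=> p /activeP[[[r i] j]].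
rewrite inE => /andP[_]; rewrite inE /=.
case: i j => [u|] // [v|].
  by case/and3P=> nu nv _ /orP[] /eqP[<-].
rewrite orbF => /orP[/andP[nu _]|/and3P[Ku _ _]] /eqP[<-] //.
by have /setIP[] := subsetP hK u Ku.
Qed.

(** The parent relation may be cyclic, so the induction follows the consensus derivation of [W] from
    the primes and not the table. *)
Lemma ancestors_covered f K T C r : adequate (all_triples f K) T ->
  closed_under T C -> primeset f (Anc T r) \subset C -> Anc T r \subset C.
Proof.
case=> aT hT sT clC primC; have AT := subset_trans (Anc_active T r) aT.
have nA W : W \in Anc T r -> W \in nonfree f.
  by move/(subsetP AT)/(subsetP hT); rewrite heads_all_triples.
apply/subsetP=> W AW; have /setDP[PW _] := nA W AW.
move: W PW AW; apply: Consensus_ind => [U PU AU|U V W PU PV CU CV UVW AW].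
  by apply: (subsetP primC); rewrite inE AU.
have [b Bb [bW pb]] := consensus_entry K PU PV UVW (nA W AW).
have [|e Te [eb pe]] := sT b Bb; first by rewrite bW (subsetP AT).
rewrite -bW -eb; apply: clC => //; apply/subsetP=> p ep.
have Ap : p \in Anc T r.
  by apply: (subsetP (@parents_Anc T r e Te _)) ep; right; rewrite eb bW.
(* An erased [U] or [V] may lie outside the ancestor set; the induction hypothesis is applied only
   to one that is still a parent. *)
have := subsetP pb p (subsetP pe p ep); rewrite !inE.
by case/orP=> /eqP Ep; rewrite Ep in Ap *; [apply: CU | apply: CV].
Qed.

(** [C] stays fixed while the table shrinks; [card_next_table] keeps the fuel [k] sufficient for the
    remaining rounds. *)
Lemma rounds_covered f K C k T : #|T| <= k ->
  adequate (all_triples f K) T -> closed_under T C ->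
  (forall A, A \in independent_rounds k T -> primeset f A \subset C) ->
  heads T \subset C.
Proof.
elim: k T => [|k IH] T /=.
  rewrite leqn0 cards_eq0 => /eqP-> _ _ _.
  by apply/subsetP=> r /headsP[e]; rewrite inE.
case: eqP => [-> _ _ _ _|/eqP T0 leT adT clT primC].
  by apply/subsetP=> r /headsP[e]; rewrite inE.
apply: (heads_reduce_closed adT) => //.
have adR := adequate_reduce adT; have clR := closed_sub (reduce_sub T) clT.
have leR := subset_leq_card (reduce_sub T).
set R := reduce T in adR clR leR primC *.
case: (eqVneq R set0) => [-> |R0].
  by apply/subsetP=> r /headsP[e]; rewrite inE.
have QC : \bigcup_(A in independent_sets R) A \subset C.
  apply/bigcupsP=> A IA; have [r _ EA] := independentP IA.
  rewrite EA; apply: (ancestors_covered adR clR); rewrite -EA.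
  by apply: primC; rewrite mem_cat mem_enum IA.
have := IH (next_table R); rewrite next_tableE.
set Q := \bigcup_(A in _) A in QC *; set T' := R :\: _; set L := cover Q T'.
rewrite -next_tableE => IHn.
have LC : L \subset C.
  by apply: cover_min => //; apply: closed_sub clR; apply: subsetDl.
have {}IHn : heads (next_table R) \subset C.
  apply: IHn.
  - rewrite -ltnS; apply: leq_trans leT; apply: leq_trans leR.
    exact: card_next_table adR R0.
  - exact: adequate_next.
  (* The parents erased from an entry lie in [L], hence in [C], so closure under the original entry
     applies. *)
  - rewrite next_tableE => x /imsetP[e]; rewrite inE => /andP[/setDP[Re _] _] ->.
    rewrite head_replace0 parents_replace0 subDset => se.
    by apply: clR => //; apply: subset_trans se _; rewrite subUset LC subxx.
  by move=> A IA; apply: primC; rewrite mem_cat IA orbT.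
(* A head of [R] is either covered in this round or still a head in the next table. *)
apply/subsetP=> _ /headsP[e Re ->].
case Le: (head e \in L); first exact: (subsetP LC).
apply: (subsetP IHn); rewrite -(head_replace0 L) next_tableE.
apply/head_in/imset_f; rewrite inE Le andbT inE Re andbT.
apply/negP=> /bigcupP[A IA]; rewrite inE => /and3P[_ Ae _].
case/negP: (negbT Le); apply: (subsetP (sub_cover Q T')).
by apply/bigcupP; exists A.
Qed.

End Tables.

Theorem theorem5p1 (n : nat) (f : boolfun n) (K : {set product n})
    (hK : K \subset nonfree_primes f) :
  products_of (triples f K) \subset
    cascade_list (\bigcup_(PS <- canonical_primesets f K) PS) (triples f K).
Proof.
have adT := adequate_reduce (adequate_all_triples hK).
have [aT _ _] := adT; rewrite -/(triples f K) in adT aT.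
(* Every active product is a head, so only heads remain to be covered. *)
rewrite /products_of (setUidPl aT) cascade_listE.
apply: (rounds_covered (leqnn _) adT) => [|A IA]; first exact: closed_cover.
apply: subset_trans (sub_cover _ _); rewrite big_map.
by rewrite (big_rem A) //= subsetUl.
Qed.
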